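(* Let $(H,\Delta)$ be a Hopf algebra with invariant functionals, $(A,\alpha)$ an $I$-Galois object, and $\psi_A$ a left complete invariant functional on $A$. Then there is a bijection $\mu:I\to I$ such that $\psi_{ij}\neq0$ if and only if $j=\mu(i)$. Moreover, for any invariant functional $\widetilde\psi$ on $A$ there are scalars $c_i\in k$ ($i\in I$) such that $\widetilde\psi_{ij}=\delta_{j,\mu(i)}c_i\psi_{ij}$ for all $i,j\in I$.
   Context: $H$ has invariant functionals: nonzero $\varphi,\psi:H\to k$ with $(\mathrm{id}\otimes\varphi)\Delta(h)=\varphi(h)1$, $(\psi\otimes\mathrm{id})\Delta(h)=\psi(h)1$. An $I$-Galois object is a right $H$-comodule algebra $(A,\alpha)$ (possibly non-unital) with bijective Galois map $A\otimes_{A^\alpha}A\to A\otimes H$, $a\otimes b\mapsto(a\otimes1)\alpha(b)$, and coinvariant algebra $A^\alpha$ identified with $k_I=\bigoplus_{i\in I}k$, minimal idempotents $p_i$. A functional $\chi:A\to k$ is invariant if $(\chi\otimes\mathrm{id})\alpha(x)=\chi(x)1_H$ for all $x$; left complete if $\chi(p_i\,\cdot)\ne0$ for all $i$. For a functional $\chi$, $\chi_{ij}:A\to k$, $a\mapsto\chi(p_iap_j)$; $\delta_{j,\mu(i)}$ is the Kronecker delta. *)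

(* Defs.v *)
From HB Require Import structures.
From mathcomp Require Import all_boot all_order all_algebra.
Set Implicit Arguments. Unset Strict Implicit. Unset Printing Implicit Defensive.
Import Order.TTheory GRing.Theory Num.Theory.
Local Open Scope ring_scope.

Section Defs.
Variable k : fieldType.

Definition bilin (U V W : lmodType k) (f : U -> V -> W) : Prop :=
  (forall v, linear (fun u => f u v)) /\ (forall u, linear (f u)).

Record tensor (U V : lmodType k) := Tensor {
  tspace :> lmodType k;
  tens : U -> V -> tspace;
  tens_bilin : bilin tens;
  tens_univ : forall (W : lmodType k) (f : U -> V -> W), bilin f ->
    exists g : tspace -> W, [/\ linear g, (forall u v, g (tens u v) = f u v) &
      forall g' : tspace -> W, linear g' ->
        (forall u v, g' (tens u v) = f u v) -> g' =1 g] }.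

Definition induced {U V W : lmodType k} (T : tensor U V) (f : U -> V -> W)
  (g : T -> W) : Prop :=
  linear g /\ forall u v, g (tens T u v) = f u v.
Arguments induced {U V W} T f g.

Record btensor (A : lmodType k) (mul : A -> A -> A) (B : A -> Prop) := BTensor {
  bspace :> lmodType k;
  btens : A -> A -> bspace;
  btens_bilin : bilin btens;
  btens_bal : forall a b c, B b -> btens (mul a b) c = btens a (mul b c);
  btens_univ : forall (W : lmodType k) (f : A -> A -> W), bilin f ->
    (forall a b c, B b -> f (mul a b) c = f a (mul b c)) ->
    exists g : bspace -> W, [/\ linear g, (forall u v, g (btens u v) = f u v) &
      forall g' : bspace -> W, linear g' ->
        (forall u v, g' (btens u v) = f u v) -> g' =1 g] }.

Definition binduced {A : lmodType k} {mul : A -> A -> A} {B : A -> Prop}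
  {W : lmodType k} (T : btensor mul B) (f : A -> A -> W) (g : T -> W) : Prop :=
  linear g /\ forall u v, g (btens T u v) = f u v.
Arguments binduced {A mul B W} T f g.

Definition tmul {U V : lmodType k} (T : tensor U V) (mU : U -> U -> U)
  (mV : V -> V -> V) (m : T -> T -> T) : Prop :=
  bilin m /\ forall a b c d, m (tens T a b) (tens T c d) = tens T (mU a c) (mV b d).
Arguments tmul {U V} T mU mV m.

Definition hopf (H : algType k) (T2 : tensor H H) (T3 : tensor T2 H)
  (Delta : H -> T2) (eps : H -> k) (S : H -> H) : Prop :=
  [/\ linear Delta,
      (forall m, tmul T2 *%R *%R m ->
         forall x y, Delta (x * y) = m (Delta x) (Delta y)) /\ Delta 1 = tens T2 1 1,
      (* coassociativity: (Delta (x) id) Delta = (id (x) Delta) Delta *)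
      (forall L1, induced T2 (fun x y => tens T3 (Delta x) y) L1 ->
       forall R : H -> T2 -> T3,
         (forall x, induced T2 (fun u v => tens T3 (tens T2 x u) v) (R x)) ->
       forall L2, induced T2 (fun x y => R x (Delta y)) L2 ->
       forall h, L1 (Delta h) = L2 (Delta h)),
      [/\ scalar eps, (forall x y, eps (x * y) = eps x * eps y), eps 1 = 1,
          (forall L, induced T2 (fun x y => eps x *: y) L -> forall h, L (Delta h) = h) &
          (forall L, induced T2 (fun x y => eps y *: x) L -> forall h, L (Delta h) = h)] &
      [/\ linear S,
          (forall L, induced T2 (fun x y => S x * y) L ->
             forall h, L (Delta h) = eps h *: 1) &
          (forall L, induced T2 (fun x y => x * S y) L ->
             forall h, L (Delta h) = eps h *: 1)]].

Definition left_inv_fun (H : algType k) (T2 : tensor H H) (Delta : H -> T2)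
  (phi : H -> k) : Prop :=
  [/\ scalar phi, (exists h, phi h != 0) &
      forall L, induced T2 (fun x y => phi y *: x) L ->
        forall h, L (Delta h) = phi h *: 1].

Definition right_inv_fun (H : algType k) (T2 : tensor H H) (Delta : H -> T2)
  (psi : H -> k) : Prop :=
  [/\ scalar psi, (exists h, psi h != 0) &
      forall L, induced T2 (fun x y => psi x *: y) L ->
        forall h, L (Delta h) = psi h *: 1].

Definition comod_alg (H : algType k) (T2 : tensor H H) (Delta : H -> T2)
  (eps : H -> k) (A : lmodType k) (mulA : A -> A -> A) (TAH : tensor A H)
  (T3A : tensor TAH H) (alpha : A -> TAH) : Prop :=
  [/\ bilin mulA /\ associative mulA, linear alpha,
      (forall m, tmul TAH mulA *%R m ->
         forall a b, alpha (mulA a b) = m (alpha a) (alpha b)),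
      (* (alpha (x) id) alpha = (id (x) Delta) alpha *)
      (forall L1, induced TAH (fun a h => tens T3A (alpha a) h) L1 ->
       forall R : A -> T2 -> T3A,
         (forall a, induced T2 (fun u v => tens T3A (tens TAH a u) v) (R a)) ->
       forall L2, induced TAH (fun a h => R a (Delta h)) L2 ->
       forall x, L1 (alpha x) = L2 (alpha x)) &
      (forall L, induced TAH (fun a h => eps h *: a) L -> forall x, L (alpha x) = x)].

Definition coinv (H : algType k) (A : lmodType k) (TAH : tensor A H)
  (alpha : A -> TAH) (a : A) : Prop := alpha a = tens TAH a 1.

Definition galois_map_bij (H : algType k) (A : lmodType k) (mulA : A -> A -> A)
  (TAH : tensor A H) (alpha : A -> TAH) (TB : btensor mulA (coinv alpha)) : Prop :=
  forall m, tmul TAH mulA *%R m ->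
  forall G, binduced TB (fun a b => m (tens TAH a 1) (alpha b)) G -> bijective G.

(* A^alpha is identified with k_I = (+)_{i in I} k, p i being the image of the
   minimal idempotent at i. *)
Definition coinv_kI (H : algType k) (A : lmodType k) (mulA : A -> A -> A)
  (TAH : tensor A H) (alpha : A -> TAH) (I : eqType) (p : I -> A) : Prop :=
  [/\ forall i, coinv alpha (p i),
      forall i j, mulA (p i) (p j) = (if i == j then p i else 0),
      forall i, p i != 0 &
      forall a, coinv alpha a ->
        exists (s : seq I) (c : I -> k), a = \sum_(i <- s) c i *: p i].

Definition inv_fun (H : algType k) (A : lmodType k) (TAH : tensor A H)
  (alpha : A -> TAH) (chi : A -> k) : Prop :=
  scalar chi /\
  forall L, induced TAH (fun a h => chi a *: h) L ->
    forall x, L (alpha x) = chi x *: 1.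

Definition left_complete (A : lmodType k) (mulA : A -> A -> A) (I : eqType)
  (p : I -> A) (chi : A -> k) : Prop :=
  forall i, exists a, chi (mulA (p i) a) != 0.

Definition fij (A : lmodType k) (mulA : A -> A -> A) (I : eqType)
  (p : I -> A) (chi : A -> k) (i j : I) : A -> k :=
  fun a => chi (mulA (mulA (p i) a) (p j)).

End Defs.

(* Main.v *)
Require Import Defs.
From HB Require Import structures.
From mathcomp Require Import all_boot all_order all_algebra.
From mathcomp Require Import boolp ring.
Set Implicit Arguments. Unset Strict Implicit. Unset Printing Implicit Defensive.
Import Order.TTheory GRing.Theory Num.Theory.
Local Open Scope ring_scope.

(* Write E(a) = a_0 phi(a_1), a map A -> A^alpha, and F(b) = b_0 w(b_1) with
   w = phi o S, which is right invariant.  Strong invariance of an invariant functional chi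
   gives chi(E(a) b) = chi(a F(b)).  On H one has h_1 w(h_2) = w(h) d for a group-like d,
   because w(h_1 y) w(h_2) = w(h) w(S y) and w is faithful; hence F takes values in
   A_d = {x | alpha(x) = x (x) d}.  Surjectivity of the Galois map gives A = A A_d = A A_(S d),
   while A_d A_(S d) and A_(S d) A_d lie in A^alpha = k_I.  So A_d is an invertible
   k_I-bimodule, i.e. p_i A_d p_j is a line if j = mu(i) and 0 otherwise, for a bijection mu.
   Choosing a with E(a) = p_i, chi(p_i b p_j) = chi(a F(p_i b p_j)) depends on chi only through
   its value at a u_i, where u_i spans p_i A_d p_(mu i). *)

(** * Submodules spanned by a family of vectors *)

Section Span.
Variables (k : fieldType) (T : lmodType k) (J : Type) (e : J -> T).

Definition in_span : {pred T} :=
  fun t => `[< exists s : seq (k * J), t = \sum_(q <- s) q.1 *: e q.2 >].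

Fact in_span_submod : submod_closed in_span.
Proof.
split; first by apply/asboolP; exists [::]; rewrite big_nil.
move=> c x y /asboolP[s ->] /asboolP[t ->]; apply/asboolP.
exists ([seq (c * q.1, q.2) | q <- s] ++ t).
rewrite big_cat big_map scaler_sumr /=; congr (_ + _).
by apply: eq_bigr => q _; rewrite scalerA.
Qed.

HB.instance Definition _ := GRing.isSubmodClosed.Build k T in_span in_span_submod.

(** The universal properties of [tensor] and [btensor] range over modules, so the span must itself
    be packed as an [lmodType]. *)
Definition span_sub := {t : T | in_span t}.
HB.instance Definition _ := SubType.on span_sub.
HB.instance Definition _ := Choice.on span_sub.
HB.instance Definition _ := [SubChoice_isSubLmodule of span_sub by <:].

Lemma mem_span j : in_span (e j).
Proof. by apply/asboolP; exists [:: (1, j)]; rewrite big_seq1 scale1r. Qed.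

Definition to_span j : span_sub := Sub (e j) (mem_span j).

Lemma span_full :
  (exists g : T -> span_sub, forall t, val (g t) = t) ->
  forall t, exists s : seq (k * J), t = \sum_(q <- s) q.1 *: e q.2.
Proof. by move=> [g gK] t; move: (valP (g t)); rewrite gK => /asboolP. Qed.

End Span.

(** * Linear maps, spanning by pure tensors, Sweedler sums *)

Section Linear.
Variable k : fieldType.
Implicit Types U V W X : lmodType k.

Lemma lin0 U V (f : U -> V) : linear f -> f 0 = 0.
Proof. by move=> lf; have := lf (-1) 0 0; rewrite !scaleN1r !oppr0 !addr0 => ->; rewrite addNr. Qed.

Lemma linD U V (f : U -> V) : linear f -> {morph f : x y / x + y}.
Proof. by move=> lf x y; have := lf 1 x y; rewrite !scale1r. Qed.

Lemma linZ U V (f : U -> V) : linear f -> forall c x, f (c *: x) = c *: f x.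
Proof. by move=> lf c x; have := lf c x 0; rewrite (lin0 lf) !addr0. Qed.

Lemma lin_sum U V (f : U -> V) (lf : linear f) J (s : seq J) (F : J -> U) :
  f (\sum_(j <- s) F j) = \sum_(j <- s) f (F j).
Proof.
elim: s => [|j s IH]; first by rewrite !big_nil (lin0 lf).
by rewrite !big_cons (linD lf) IH.
Qed.

Lemma lin_id U : linear (@id U). Proof. by []. Qed.

Lemma lin_comp U V W (g : V -> W) (f : U -> V) :
  linear g -> linear f -> linear (fun x => g (f x)).
Proof. by move=> lg lf c x y; rewrite lf lg. Qed.

Lemma lin_bigsum U V J (s : seq J) (F : J -> U -> V) :
  (forall j, linear (F j)) -> linear (fun x => \sum_(j <- s) F j x).
Proof.
move=> lF c x y; rewrite scaler_sumr -big_split.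
by apply: eq_bigr => j _; rewrite lF.
Qed.

(* The universal property, applied to the submodule spanned by the pure tensors, splits its
   inclusion. *)
Lemma tens_span U V (T : tensor U V) (t : T) :
  exists s : seq (U * V), t = \sum_(q <- s) tens T q.1 q.2.
Proof.
pose e (q : U * V) := tens T q.1 q.2.
have [bl br] := tens_bilin T.
have [|g [lg ge _]] := @tens_univ _ _ _ T _ (fun u v => to_span e (u, v)).
  by split=> [v c x y|u c x y]; apply: val_inj; [exact: bl|exact: br].
have lv : linear (fun t => val (g t)) by move=> c x y; rewrite lg.
have [h [_ _ hu]] := @tens_univ _ _ _ T _ _ (tens_bilin T).
have [|s ->] := @span_full _ _ _ e _ t.
  exists g => t'; rewrite (hu _ lv) => [|u v]; last by rewrite ge.
  by rewrite -(hu id).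
exists [seq (q.1 *: q.2.1, q.2.2) | q <- s]; rewrite big_map.
by apply: eq_bigr => q _ /=; rewrite (linZ (bl _)).
Qed.

Lemma btens_span (A : lmodType k) (mul : A -> A -> A) (B : A -> Prop)
    (T : btensor mul B) (t : T) :
  exists s : seq (A * A), t = \sum_(q <- s) btens T q.1 q.2.
Proof.
pose e (q : A * A) := btens T q.1 q.2.
have [bl br] := btens_bilin T.
have [||g [lg ge _]] := @btens_univ _ _ _ _ T _ (fun u v => to_span e (u, v)).
- by split=> [v c x y|u c x y]; apply: val_inj; [exact: bl|exact: br].
- by move=> a b c Bb; apply: val_inj; rewrite /= /e /= btens_bal.
have lv : linear (fun t => val (g t)) by move=> c x y; rewrite lg.
have [h [_ _ hu]] := @btens_univ _ _ _ _ T _ _ (btens_bilin T) (@btens_bal _ _ _ _ T).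
have [|s ->] := @span_full _ _ _ e _ t.
  exists g => t'; rewrite (hu _ lv) => [|u v]; last by rewrite ge.
  by rewrite -(hu id).
exists [seq (q.1 *: q.2.1, q.2.2) | q <- s]; rewrite big_map.
by apply: eq_bigr => q _ /=; rewrite (linZ (bl _)).
Qed.

Section Contraction.
Variables (U V : lmodType k) (T : tensor U V).

(* The Sweedler sum f(t_1, t_2); it depends on the chosen representation of t unless f is
   bilinear. *)
Definition contr W (f : U -> V -> W) (t : T) : W :=
  \sum_(q <- projT1 (cid (tens_span t))) f q.1 q.2.

(** Linearity of [g] evaluates it on any representation of [t], so the chosen one no longer matters.
    Hypotheses quantified over all induced maps thereby become identities between Sweedler sums. *)
Lemma contrE W (f : U -> V -> W) (g : T -> W) : induced f g -> contr f =1 g.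
Proof.
move=> [lg gE] t; rewrite /contr; case: cid => s /= ->.
by rewrite (lin_sum lg); apply: eq_bigr => q _; rewrite gE.
Qed.

Lemma contr_induced W (f : U -> V -> W) : bilin f -> induced f (contr f).
Proof.
move=> bf; have [g [lg gE _]] := @tens_univ _ _ _ T _ _ bf.
have fE := contrE (conj lg gE).
by split=> [c x y|u v]; rewrite !fE ?lg.
Qed.

Lemma lin_contr W (f : U -> V -> W) : bilin f -> linear (contr f).
Proof. by move=> /contr_induced[]. Qed.

Lemma contr_tens W (f : U -> V -> W) u v : bilin f -> contr f (tens T u v) = f u v.
Proof. by move=> /contr_induced[]. Qed.

Lemma contr_id t : contr (tens T) t = t.
Proof. by apply: (contrE (g := id)). Qed.

Lemma eq_contr W (f g : U -> V -> W) t : (forall u v, f u v = g u v) -> contr f t = contr g t.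
Proof. by move=> fg; apply: eq_bigr. Qed.

Lemma contr_comp W (X : lmodType k) (g : W -> X) (f : U -> V -> W) t : linear g ->
  g (contr f t) = contr (fun u v => g (f u v)) t.
Proof. by move=> lg; rewrite /contr lin_sum. Qed.

Lemma contr_scale W c (f : U -> V -> W) t : c *: contr f t = contr (fun u v => c *: f u v) t.
Proof. exact: scaler_sumr. Qed.

Lemma lin_contr_par W (X : lmodType k) (f : X -> U -> V -> W) t :
  (forall u v, linear (fun x => f x u v)) -> linear (fun x => contr (f x) t).
Proof. by move=> lf; apply: lin_bigsum. Qed.

End Contraction.

Lemma contr_exchange U V U' V' (T : tensor U V) (T' : tensor U' V') W
    (f : U -> V -> U' -> V' -> W) (t : T) (t' : T') :
  contr (fun u v => contr (f u v) t') t = contr (fun u' v' => contr (fun u v => f u v u' v') t) t'.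
Proof. exact: exchange_big. Qed.

End Linear.

(** * Automation of linearity and bilinearity proofs *)

Section LinearTactic.
Variable k : fieldType.
Implicit Types U V W X : lmodType k.

Lemma lin_scale_l U V (f : U -> k) (w : V) : scalar f -> linear (fun x => f x *: w).
Proof. by move=> lf c x y; rewrite lf scalerDl scalerA. Qed.

Lemma scalar_comp U V (g : V -> k) (f : U -> V) :
  scalar g -> linear f -> scalar (fun x => g (f x)).
Proof. by move=> lg lf c x y; rewrite lf lg. Qed.

Lemma lin_scale_r U V (c : k) (f : U -> V) : linear f -> linear (fun x => c *: f x).
Proof. by move=> lf d x y; rewrite lf scalerDr !scalerA mulrC. Qed.

Lemma lin_mul_l U (H : algType k) (f : U -> H) (w : H) : linear f -> linear (fun x => f x * w).
Proof. by move=> lf c x y; rewrite lf mulrDl scalerAl. Qed.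

Lemma lin_mul_r U (H : algType k) (w : H) (f : U -> H) : linear f -> linear (fun x => w * f x).
Proof. by move=> lf c x y; rewrite lf mulrDr scalerAr. Qed.

Lemma lin_bil_l U V W X (op : V -> W -> X) (f : U -> V) w :
  bilin op -> linear f -> linear (fun x => op (f x) w).
Proof. by move=> [bl _] lf c x y; rewrite lf; apply: bl. Qed.

Lemma lin_bil_r U V W X (op : V -> W -> X) (f : U -> W) w :
  bilin op -> linear f -> linear (fun x => op w (f x)).
Proof. by move=> [_ br] lf c x y; rewrite lf; apply: br. Qed.

Lemma lin_contr_arg U V W X (T : tensor V W) (F : V -> W -> X) (f : U -> T) :
  bilin F -> linear f -> linear (fun x => contr F (f x)).
Proof. by move=> bF lf c x y; rewrite lf; apply: lin_contr. Qed.

End LinearTactic.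

(** Recursion on the body of the abstraction: scaling, products and contractions are tried first,
    then the variable inside an argument of a bilinear or linear map. *)
Ltac lin :=
  cbv beta; lazymatch goal with
  | |- bilin _ => solve [assumption | apply: tens_bilin | split; (intros ?; lin)]
  | |- GRing.linear_for _ _ => first
    [ assumption
    | apply: lin_id
    | match goal with
      | h : bilin ?op |- GRing.linear_for _ (?op _) => exact (proj2 h _)
      | |- GRing.linear_for _ (fun x => GRing.scale ?w (@?f x)) =>
             apply: (lin_scale_r w (f := f)); lin
      | |- GRing.linear_for _ (fun x => GRing.scale (@?f x) ?w) =>
             apply: (lin_scale_l (f := f) w); lin
      | |- GRing.linear_for _ (fun x => GRing.mul ?w (@?f x)) =>
             apply: (lin_mul_r w (f := f)); lin
      | |- GRing.linear_for _ (fun x => GRing.mul (@?f x) ?w) =>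
             apply: (lin_mul_l (f := f) w); lin
      | |- GRing.linear_for _ (fun x => @contr _ _ _ ?T _ (@?F x) ?t) =>
             apply: (lin_contr_par (f := F) t);
             (intros ? ?; lin)
      | |- GRing.linear_for _ (fun x => @contr _ _ _ ?T _ ?F (@?t x)) =>
             apply: (lin_contr_arg (F := F) (f := t)); lin
      | |- GRing.linear_for _ (fun x => ?op ?w (@?f x)) =>
             first [apply: (lin_bil_r (op := op) (f := f) w); lin |
                    apply: (lin_comp (g := op w) (f := f)); lin]
      | |- GRing.linear_for _ (fun x => ?op (@?f x) ?w) =>
             apply: (lin_bil_l (op := op) (f := f) w); lin
      | |- GRing.linear_for _ (fun x => ?g (@?f x)) =>
             first [apply: (scalar_comp (g := g) (f := f)); lin |
                    apply: (lin_comp (g := g) (f := f)); lin]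
      end ]
  end.

Definition trilin (k : fieldType) (U V W X : lmodType k) (f : U -> V -> W -> X) : Prop :=
  [/\ forall v w, linear (fun u => f u v w), forall u w, linear (fun v => f u v w)
    & forall u v, linear (f u v)].

(** * The product on a tensor product of algebras *)

Section TensorProduct.
Variables (k : fieldType) (U V : lmodType k) (T : tensor U V).
Variables (mU : U -> U -> U) (mV : V -> V -> V).
Hypotheses (bU : bilin mU) (bV : bilin mV).

(** The axioms on [Delta], [alpha] and the Galois map quantify over all products satisfying [tmul];
    this is the one they are applied to. *)
Definition tensor_mul (s t : T) : T :=
  contr (fun a b => contr (fun c d => tens T (mU a c) (mV b d)) t) s.

Lemma bilin_tensor_mul : bilin tensor_mul.
Proof. have bT := tens_bilin T; rewrite /tensor_mul; lin. Qed.

Lemma tensor_mulP : tmul mU mV tensor_mul.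
Proof.
have bT := tens_bilin T.
split=> [|a b c d]; first exact: bilin_tensor_mul.
by rewrite /tensor_mul !contr_tens //; lin.
Qed.

Lemma contr_tensor_mul (W : lmodType k) (f : U -> V -> W) s t : bilin f ->
  contr f (tensor_mul s t) = contr (fun a b => contr (fun c d => f (mU a c) (mV b d)) t) s.
Proof.
move=> bf; have bT := tens_bilin T; rewrite /tensor_mul contr_comp; last exact: lin_contr.
apply: eq_contr => a b; rewrite contr_comp; last exact: lin_contr.
by apply: eq_contr => c d; rewrite contr_tens.
Qed.

End TensorProduct.

(** * Comodule algebras in Sweedler form *)

Section Comodule.
Variables (k : fieldType) (H : algType k) (T2 : tensor H H) (Delta : H -> T2) (eps : H -> k).
Variables (A : lmodType k) (mulA : A -> A -> A) (TAH : tensor A H) (T3A : tensor TAH H).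
Variable alpha : A -> TAH.
Hypotheses (lDelta : linear Delta) (leps : scalar eps).
Hypothesis hA : comod_alg Delta eps mulA T3A alpha.

Lemma bilin_alg_mul (R : algType k) : bilin (fun x y : R => x * y).
Proof. lin. Qed.

Let bmulA : bilin mulA. Proof. by case: hA => -[]. Qed.
Let lalpha : linear alpha. Proof. by case: hA. Qed.

(** Both sides are images of the two iterated coactions under the map [T3A -> W] induced by [f].
    That map is built in two rounds, since [T3A] is a tensor product over [TAH]. *)
Lemma coact_assoc (W : lmodType k) (f : A -> H -> H -> W) x : trilin f ->
  contr (fun a h => contr (fun b l => f b l h) (alpha a)) (alpha x) =
  contr (fun a h => contr (f a) (Delta h)) (alpha x).
Proof.
move=> [f1 f2 f3]; case: hA => _ _ _ co _.
have b3 := tens_bilin T3A; have b2 := tens_bilin TAH.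
have bR a : bilin (fun u v => tens T3A (tens TAH a u) v) by lin.
have b1 : bilin (fun a h => tens T3A (alpha a) h) by lin.
pose R a := contr (T := T2) (fun u v => tens T3A (tens TAH a u) v).
have bL2 : bilin (fun a h => R a (Delta h)).
  by split=> u; [apply: lin_contr_par => *; lin | rewrite /R; lin].
have := co _ (contr_induced _ b1) R (fun a => contr_induced _ (bR a)) _ (contr_induced _ bL2) x.
have bf h : bilin (fun a l => f a l h) by split=> ?; [apply: f1 | apply: f2].
have bF : bilin (fun t h => contr (T := TAH) (fun a l => f a l h) t).
  by split=> *; [apply: lin_contr|apply: lin_contr_par].
move=> /(congr1 (contr (T := T3A) (fun t h => contr (T := TAH) (fun a l => f a l h) t))).
rewrite !contr_comp; try exact: lin_contr.
under eq_contr => u v do rewrite contr_tens //.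
move=> ->; apply: eq_contr => a h; rewrite /R contr_comp; last exact: lin_contr.
by apply: eq_contr => u v; rewrite !contr_tens.
Qed.

Lemma coactM a b : alpha (mulA a b) = tensor_mul mulA *%R (alpha a) (alpha b).
Proof. by case: hA => _ _ am _ _; apply: am; apply: tensor_mulP => //; apply: bilin_alg_mul. Qed.

Lemma contr_coactM (W : lmodType k) (f : A -> H -> W) a b : bilin f ->
  contr f (alpha (mulA a b)) =
  contr (fun x h => contr (fun y l => f (mulA x y) (h * l)) (alpha b)) (alpha a).
Proof. by move=> bf; rewrite coactM contr_tensor_mul //; apply: bilin_alg_mul. Qed.

Lemma coact_counit x : contr (fun a h => eps h *: a) (alpha x) = x.
Proof. by case: hA => _ _ _ _ au; apply: au; apply: contr_induced; lin. Qed.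

Lemma contr_counit (W : lmodType k) (g : A -> W) x : linear g ->
  contr (fun a h => eps h *: g a) (alpha x) = g x.
Proof.
move=> lg; rewrite -[in RHS](coact_counit x) contr_comp //.
by apply: eq_contr => a h; rewrite (linZ lg).
Qed.

End Comodule.

(** * Hopf algebra identities for the antipode *)

Section Hopf.
Variables (k : fieldType) (H : algType k) (T2 : tensor H H) (T3 : tensor T2 H).
Variables (Delta : H -> T2) (eps : H -> k) (S : H -> H).
Hypothesis hH : hopf T3 Delta eps S.

Lemma linear_Delta : linear Delta. Proof. by case: hH. Qed.
Lemma scalar_eps : scalar eps. Proof. by case: hH => _ _ _ [? _ _ _ _] _. Qed.
Lemma linear_antipode : linear S. Proof. by case: hH => _ _ _ _ []. Qed.
Let lD := linear_Delta.
Let le := scalar_eps.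
Let lS := linear_antipode.

(** [H] coacts on itself, so every comodule statement also applies to [H]. *)
Lemma hopf_comod_alg : comod_alg Delta eps *%R T3 Delta.
Proof.
case: hH => _ [dM _] dco [_ _ _ _ du] _.
by split=> //; split; [apply: bilin_alg_mul | apply: mulrA].
Qed.

Let coassoc := fun W f => @coact_assoc _ _ _ _ _ _ _ _ _ _ lD hopf_comod_alg W f.
Let DeltaM := fun W f => @contr_coactM _ _ _ _ _ _ _ _ _ _ hopf_comod_alg W f.

Lemma contr_Delta1 (W : lmodType k) (f : H -> H -> W) : bilin f -> contr f (Delta 1) = f 1 1.
Proof. by case: hH => _ [_ ->] _ _ _ bf; rewrite contr_tens. Qed.

Lemma contr_counitr (W : lmodType k) (g : H -> W) x : linear g ->
  contr (fun a h => eps h *: g a) (Delta x) = g x.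
Proof. exact: (contr_counit le hopf_comod_alg). Qed.

Lemma contr_counitl (W : lmodType k) (g : H -> W) x : linear g ->
  contr (fun a h => eps a *: g h) (Delta x) = g x.
Proof.
case: hH => _ _ _ [_ _ _ ul _] _ lg.
have xE : contr (fun a h => eps a *: h) (Delta x) = x by apply: ul; apply: contr_induced; lin.
by rewrite -[in RHS]xE contr_comp //; apply: eq_contr => a h; rewrite (linZ lg).
Qed.

Lemma contr_antipodel x : contr (fun a h => S a * h) (Delta x) = eps x *: 1.
Proof. by case: hH => _ _ _ _ [_ sl _]; apply: sl; apply: contr_induced; lin. Qed.

Lemma contr_antipoder x : contr (fun a h => a * S h) (Delta x) = eps x *: 1.
Proof. by case: hH => _ _ _ _ [_ _ sr]; apply: sr; apply: contr_induced; lin. Qed.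

(* From Delta(S x1 * x2) = eps x, cancel the second tensor leg on the right with S x3. *)
Lemma Delta_antipode_mulr (W : lmodType k) (f : H -> H -> W) x : bilin f ->
  contr (fun a b => contr (fun u v => f (u * b) v) (Delta (S a))) (Delta x) = f 1 (S x).
Proof.
move=> bf.
(* Here [x] is split into a, y, z1, z2. Collapsing z1 S(z2) gives the left-hand side; regrouping y,
   z1 as the coproduct of some w and collapsing S(a) w gives the right-hand side. *)
pose Phi a y z1 z2 := contr (fun u v => f (u * y) (v * z1 * S z2)) (Delta (S a)).
pose Psi a w z2 := contr (fun y z1 => Phi a y z1 z2) (Delta w).
have PsiE a w z2 : Psi a w z2 = contr (fun p q => f p (q * S z2)) (Delta (S a * w)).
  by rewrite DeltaM; [rewrite /Psi /Phi contr_exchange | lin].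
transitivity (contr (fun a b => contr (fun w z2 => Psi a w z2) (Delta b)) (Delta x)).
  apply: eq_contr => a b; rewrite /Psi coassoc; last by rewrite /Phi; split=> *; lin.
  rewrite -[LHS](contr_counitr (g := fun t => contr (fun u v => f (u * t) v) (Delta (S a))));
    last by lin.
  apply: eq_contr => y z; rewrite /Phi contr_exchange contr_scale.
  apply: eq_contr => u v.
  rewrite -(contr_comp (g := fun t => f (u * y) t)); last by lin.
  under eq_contr => z1 z2 do rewrite -mulrA.
  rewrite -(contr_comp (g := fun t => v * t)); last by lin.
  by rewrite contr_antipoder -scalerAr mulr1 (linZ (proj2 bf _)).
rewrite -coassoc; last by rewrite /Psi /Phi; split=> *; lin.
rewrite -[RHS](contr_counitl (g := fun t => f 1 (S t))); last by lin.
apply: eq_contr => w z2.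
under eq_contr => a b do rewrite PsiE.
rewrite -(contr_comp (g := fun t => contr (fun p q => f p (q * S z2)) (Delta t))); last by lin.
rewrite contr_antipodel (linZ lD) (linZ (lin_contr _)); last by lin.
by rewrite contr_Delta1 ?mul1r //; lin.
Qed.

(** Mirror image of [Delta_antipode_mulr]: from Delta(x1 S(x2)) = eps x, cancel the first tensor leg
    on the left with an antipode. *)
Lemma Delta_antipode_mull (W : lmodType k) (f : H -> H -> W) x : bilin f ->
  contr (fun a b => contr (fun u v => f u (a * v)) (Delta (S b))) (Delta x) = f (S x) 1.
Proof.
move=> bf.
pose Phi y1 y2 z b := contr (fun u v => f (S y1 * (y2 * u)) (z * v)) (Delta (S b)).
pose Psi y1 w b := contr (fun y2 z => Phi y1 y2 z b) (Delta w).
have PsiE y1 w b : Psi y1 w b = contr (fun p q => f (S y1 * p) q) (Delta (w * S b)).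
  by rewrite DeltaM; [rewrite /Psi /Phi | lin].
transitivity (contr (fun a b => contr (fun y1 w => Psi y1 w b) (Delta a)) (Delta x)).
  apply: eq_contr => a b; rewrite /Psi -coassoc; last by rewrite /Phi; split=> *; lin.
  rewrite -[LHS](contr_counitl (g := fun t => contr (fun u v => f u (t * v)) (Delta (S b))));
    last by lin.
  apply: eq_contr => y z; rewrite /Phi contr_exchange contr_scale.
  apply: eq_contr => u v.
  rewrite -(contr_comp (g := fun t => f t (z * v))); last by lin.
  under eq_contr => z1 z2 do rewrite mulrA.
  rewrite -(contr_comp (g := fun t => t * u)); last by lin.
  by rewrite contr_antipodel -scalerAl mul1r (linZ (proj1 bf _)).
rewrite coassoc; last by rewrite /Psi /Phi; split=> *; lin.
rewrite -[RHS](contr_counitr (g := fun t => f (S t) 1)); last by lin.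
apply: eq_contr => y1 w.
under eq_contr => a b do rewrite PsiE.
rewrite -(contr_comp (g := fun t => contr (fun p q => f (S y1 * p) q) (Delta t))); last by lin.
rewrite contr_antipoder (linZ lD) (linZ (lin_contr _)); last by lin.
by rewrite contr_Delta1 ?mulr1 //; lin.
Qed.

End Hopf.

(** * Tensors annihilated by a family of functionals *)

Section Annihilator.
Variables (k : fieldType) (U V : lmodType k) (T : tensor U V).

Lemma contr_sum (W : lmodType k) (f : U -> V -> W) (s : seq (U * V)) : bilin f ->
  contr (T := T) f (\sum_(q <- s) tens T q.1 q.2) = \sum_(q <- s) f q.1 q.2.
Proof.
move=> bf; rewrite (lin_sum (lin_contr bf)).
by apply: eq_bigr => q _; rewrite contr_tens.
Qed.

(* A tensor killed by all [f j (x) id] lies in (the common kernel of the [f j]) (x) V. *)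
Lemma tensor_annihilator (J : Type) (f : J -> U -> k) (t : T) :
  (forall j, scalar (f j)) -> (forall j, contr (fun u v => f j u *: v) t = 0) ->
  exists2 s : seq (U * V), t = \sum_(q <- s) tens T q.1 q.2 &
    forall q, q \in s -> forall j, f j q.1 = 0.
Proof.
move=> lf; have [s ->] := tens_span t; have [bl br] := tens_bilin T.
have bf j : bilin (fun u (v : V) => f j u *: v) by have := lf j => ?; lin.
move=> h; have {h} : forall j, \sum_(q <- s) f j q.1 *: q.2 = 0.
  by move=> j; rewrite -[RHS](h j) contr_sum.
elim: {s}(size s) {-2}s (erefl (size s)) => [|n IH] [|[u v] s] //= => [_ _|[sn] h].
  by exists [::].
have [fu|/existsNP[j0 /eqP fj0]] := pselect (forall j, f j u = 0).
  have [|s' sE s'0] := IH s sn.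
    by move=> j; have := h j; rewrite big_cons /= fu scale0r add0r.
  exists ((u, v) :: s'); first by rewrite !big_cons sE.
  by move=> q; rewrite inE => /predU1P[->|/s'0].
(* The relation for [j0] expresses [v] through the other second factors; substituting it drops one
   term and corrects each [q.1] by a multiple of [u]. *)
pose c := (f j0 u)^-1.
have vE : v = - c *: \sum_(q <- s) f j0 q.1 *: q.2.
  have := h j0; rewrite big_cons /= => /eqP; rewrite addr_eq0 => /eqP hv.
  by rewrite scaleNr -scalerN -hv scalerA mulVf ?scale1r.
pose g (q : U * V) := (q.1 - (c * f j0 q.1) *: u, q.2).
have [||s' sE s'0] := IH (map g s); first by rewrite size_map.
  move=> j; rewrite big_map /= -[RHS](h j) big_cons /= vE.
  rewrite scalerA scaler_sumr -big_split; apply: eq_bigr => q _ /=.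
  rewrite -scaleNr [q.1 + _]addrC (lf j) scalerDl scalerA.
  by congr (_ *: _ + _); ring.
exists s' => //; rewrite -sE big_map big_cons /= vE (linZ (br u)) (lin_sum (br u)).
rewrite scaler_sumr -big_split; apply: eq_bigr => q _ /=.
rewrite (linD (bl _)) -scaleNr (linZ (bl _)) (linZ (br _)) scalerA addrC.
by congr (_ + _ *: _); rewrite mulNr.
Qed.

End Annihilator.

(** * Strong invariance and slice maps *)

Section ComoduleFunctionals.
Variables (k : fieldType) (H : algType k) (T2 : tensor H H) (T3 : tensor T2 H).
Variables (Delta : H -> T2) (eps : H -> k) (S : H -> H).
Variables (A : lmodType k) (mulA : A -> A -> A) (TAH : tensor A H) (T3A : tensor TAH H).
Variable alpha : A -> TAH.
Hypothesis hH : hopf T3 Delta eps S.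
Hypothesis hA : comod_alg Delta eps mulA T3A alpha.
Let lD := linear_Delta hH.
Let le := scalar_eps hH.
Let lS := linear_antipode hH.
Let bmulA : bilin mulA. Proof. by case: hA => -[]. Qed.
Let lalpha : linear alpha. Proof. by case: hA. Qed.

Lemma inv_funE chi x : inv_fun alpha chi ->
  contr (fun a h => chi a *: h) (alpha x) = chi x *: 1.
Proof. by move=> [lchi hchi]; apply: hchi; apply: contr_induced; lin. Qed.

(** Both sides equal chi(a0 b0) a1 b1 S(b2): collapse b1 S(b2) for the left one, apply invariance of
    [chi] to the product of [a] and b0 for the right one. *)
Lemma strong_invariance chi a b : inv_fun alpha chi ->
  contr (fun x h => chi (mulA x b) *: h) (alpha a) =
  contr (fun y l => chi (mulA a y) *: S l) (alpha b).
Proof.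
move=> ichi; have lchi : scalar chi by case: ichi.
transitivity (contr (fun y l => contr (fun x h =>
    contr (fun y' l' => chi (mulA x y') *: (h * (l' * S l))) (alpha y)) (alpha a)) (alpha b)).
  rewrite contr_exchange; apply: eq_contr => x h.
  rewrite (coact_assoc lD hA (f := fun y' l' l => chi (mulA x y') *: (h * (l' * S l))));
    last by split=> *; lin.
  rewrite -[LHS](contr_counit le hA (g := fun t => chi (mulA x t) *: h)); last by lin.
  apply: eq_contr => y l.
  rewrite -(contr_comp (g := fun t => chi (mulA x y) *: (h * t))); last by lin.
  by rewrite (contr_antipoder hH) -scalerAr mulr1 !scalerA mulrC.
apply: eq_contr => y l.
rewrite -[chi (mulA a y) *: S l]mul1r -scalerAr scalerAl -(inv_funE _ ichi).
rewrite (contr_coactM hA); last by lin.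
rewrite (contr_comp (g := fun t => t * S l)); last by lin.
apply: eq_contr => x h.
rewrite (contr_comp (g := fun t => t * S l)); last by lin.
by apply: eq_contr => y' l'; rewrite -scalerAl mulrA.
Qed.

(* a |-> a_0 w(a_1) *)
Definition slice (w : H -> k) (a : A) : A := contr (fun x h => w h *: x) (alpha a).

Lemma linear_slice w : scalar w -> linear (slice w).
Proof. by move=> lw; rewrite /slice; lin. Qed.

(** Coassociativity moves the second coaction onto the [H]-leg, where the relation on [w] applies.
    For [g = 1] the slice is coinvariant. *)
Lemma coact_slice (w : H -> k) g a : scalar w ->
  (forall h, contr (fun u v => w v *: u) (Delta h) = w h *: g) ->
  alpha (slice w a) = tens TAH (slice w a) g.
Proof.
move=> lw wg; have bT := tens_bilin TAH.
rewrite /slice contr_comp //.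
rewrite (contr_comp (g := fun t => tens TAH t g)); last by lin.
transitivity (contr (fun x h => contr (fun y l => w h *: tens TAH y l) (alpha x)) (alpha a)).
  apply: eq_contr => x h.
  by rewrite (linZ lalpha) -(contr_id (alpha x)) contr_scale contr_id.
rewrite (coact_assoc lD hA (f := fun y l h => w h *: tens TAH y l)); last by split=> *; lin.
apply: eq_contr => x h.
transitivity (tens TAH x (contr (fun u v => w v *: u) (Delta h))).
  rewrite contr_comp; last by lin.
  by apply: eq_contr => u v; rewrite (linZ (proj2 bT x)).
by rewrite wg (linZ (proj2 bT x)) (linZ (proj1 bT g)).
Qed.

Lemma slice_mull w b a : scalar w -> coinv alpha b -> slice w (mulA b a) = mulA b (slice w a).
Proof.
move=> lw cb; rewrite /slice (contr_coactM hA); last by lin.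
rewrite cb contr_tens; last by lin.
rewrite contr_comp; last by lin.
by apply: eq_contr => x h; rewrite mul1r (linZ (proj2 bmulA b)).
Qed.

Lemma slice_mulr w b a : scalar w -> coinv alpha b -> slice w (mulA a b) = mulA (slice w a) b.
Proof.
move=> lw cb; rewrite /slice (contr_coactM hA); last by lin.
rewrite (contr_comp (g := fun t => mulA t b)); last by lin.
apply: eq_contr => x h; rewrite cb contr_tens; last by lin.
by rewrite mulr1 (linZ (proj1 bmulA b)).
Qed.

(** Apply [phi] to strong invariance. *)
Lemma inv_fun_slice (phi : H -> k) chi a b : scalar phi -> inv_fun alpha chi ->
  chi (mulA (slice phi a) b) = chi (mulA a (slice (fun h => phi (S h)) b)).
Proof.
move=> lphi ichi; have lchi : scalar chi by case: ichi.
(* Viewing scalars as the module [k^o] makes functionals linear maps that commute with [contr]. *)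
have lc (x : A) : linear (fun y => chi (mulA x y) : k^o).
  by move=> c y z; rewrite (proj2 bmulA) lchi.
have lc' (x : A) : linear (fun y => chi (mulA y x) : k^o).
  by move=> c y z; rewrite (proj1 bmulA) lchi.
have := congr1 phi (strong_invariance a b ichi).
rewrite (contr_comp (X := k^o) (g := phi)) // (contr_comp (X := k^o) (g := phi)) // => e.
rewrite /slice (contr_comp _ _ (lc' b)) (contr_comp _ _ (lc a)).
transitivity (contr (W := k^o) (fun u v => phi (chi (mulA u b) *: v)) (alpha a)).
  by apply: (eq_contr (W := k^o)) => u v; rewrite (linZ (lc' b)) (linZ (V := k^o) lphi) [RHS]mulrC.
rewrite e; apply: (eq_contr (W := k^o)) => u v.
by rewrite (linZ (lc a)) (linZ (V := k^o) lphi) [LHS]mulrC.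
Qed.

End ComoduleFunctionals.

(** * Invariant functionals on the Hopf algebra and the modular element *)

Section Integrals.
Variables (k : fieldType) (H : algType k) (T2 : tensor H H) (T3 : tensor T2 H).
Variables (Delta : H -> T2) (eps : H -> k) (S : H -> H).
Hypothesis hH : hopf T3 Delta eps S.
Let lD := linear_Delta hH.
Let le := scalar_eps hH.
Let lS := linear_antipode hH.
Let hC := hopf_comod_alg hH.

(** Possibly zero functionals are allowed. The right-handed version is [inv_fun Delta], with [H]
    coacting on itself. *)
Definition left_invariant (phi : H -> k) : Prop := scalar phi /\
  forall h, contr (fun u v => phi v *: u) (Delta h) = phi h *: 1.

Lemma left_inv_fun_invariant phi : left_inv_fun Delta phi -> left_invariant phi.
Proof.
by move=> [lphi _ hphi]; split=> // h; apply: hphi; apply: contr_induced; lin.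
Qed.

(** Left invariance at S(h1) replaces phi(S(h1)) 1; then h2 multiplies the first leg of
    Delta(S(h1)), as in [Delta_antipode_mulr]. *)
Lemma left_invariant_antipode phi : left_invariant phi ->
  inv_fun Delta (fun h => phi (S h)).
Proof.
move=> [lphi hphi]; split; first by apply: scalar_comp.
move=> L hL h; rewrite -(contrE hL).
rewrite -[RHS](Delta_antipode_mulr hH (f := fun u v => phi v *: u)); last by lin.
apply: eq_contr => a b.
rewrite -[b in LHS]mul1r scalerAl -hphi.
rewrite (contr_comp (g := fun t => t * b)); last by lin.
by apply: eq_contr => u v; rewrite scalerAl.
Qed.

Lemma right_invariant_antipode psi : inv_fun Delta psi ->
  left_invariant (fun h => psi (S h)).
Proof.
move=> ipsi; have lpsi : scalar psi by case: ipsi.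
split; first by apply: scalar_comp.
move=> h.
rewrite -[RHS](Delta_antipode_mull hH (f := fun u v => psi u *: v)); last by lin.
apply: eq_contr => a b.
rewrite -[a in LHS]mulr1 scalerAr -(inv_funE _ ipsi).
rewrite (contr_comp (g := fun t => a * t)); last by lin.
by apply: eq_contr => u v; rewrite scalerAr.
Qed.

(* The annihilator N of psi satisfies Delta(N) in N (x) H, and N is a right ideal; hence
   eps x = x1 S(x2) lies in N for x in N, so that eps kills N and x = eps(x1) x2 = 0. *)
Lemma right_invariant_faithful psi x : inv_fun Delta psi -> (exists h, psi h != 0) ->
  (forall y, psi (x * y) = 0) -> x = 0.
Proof.
move=> ipsi [h0 psih0] x0; have lpsi : scalar psi by case: ipsi.
have ly y : scalar (fun u => psi (u * y)) by apply: scalar_comp => //; lin.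
have dec u : (forall y, psi (u * y) = 0) -> exists2 s : seq (H * H),
    Delta u = \sum_(q <- s) tens T2 q.1 q.2 & forall q, q \in s -> forall y, psi (q.1 * y) = 0.
  move=> u0; apply: (tensor_annihilator (f := fun y u => psi (u * y))) => // y.
  (* This turns psi(u1 y) u2 into psi(u y1) S(y2), which vanishes term by term. *)
  rewrite (strong_invariance hH hC _ _ ipsi).
  by rewrite /contr big1 // => q _; rewrite u0 scale0r.
have epsN u : (forall y, psi (u * y) = 0) -> eps u = 0.
  move=> u0; have [s sE s0] := dec u u0.
  have /eqP : psi (eps u *: h0) = 0.
    rewrite -[h0]mul1r scalerAl -(contr_antipoder hH) sE contr_sum; last by lin.
    rewrite big_distrl (lin_sum (V := k^o) lpsi) big_seq big1 // => q /s0 q0.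
    by rewrite /= -mulrA q0.
  have -> : psi (eps u *: h0) = eps u * psi h0 by apply: (linZ (V := k^o) lpsi).
  by rewrite mulf_eq0 (negPf psih0) orbF => /eqP.
have [s sE s0] := dec x x0.
rewrite -[x](contr_counitl hH (g := id)) // sE contr_sum; last by lin.
by rewrite big_seq big1 // => q /s0 /epsN ->; rewrite scale0r.
Qed.

(** By [DE], psi(D(c) y) depends on [c] only through psi(c), so faithfulness forces D(c) = psi(c) d.
    Then [coact_slice] makes [d] group-like, and the antipode axioms with eps d = 1 give the inverse
    S(d). *)
Lemma modular_element psi : inv_fun Delta psi -> (exists h, psi h != 0) ->
  exists d d' : H, [/\ d * d' = 1, d' * d = 1, Delta d = tens T2 d d &
    forall c, contr (fun a b => psi b *: a) (Delta c) = psi c *: d].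
Proof.
move=> ipsi [c1 psic1]; have lpsi : scalar psi by case: ipsi.
have lpsi' : linear (psi : H -> k^o) by [].
pose D := slice Delta psi.
have DE c y : psi (D c * y) = psi c * psi (S y).
  have ly : linear (fun t : H => psi (t * y) : k^o).
    by move=> e u v; rewrite mulrDl -scalerAl lpsi.
  have ly' : linear (fun t : H => psi (c * t) : k^o).
    by move=> e u v; rewrite mulrDr -scalerAr lpsi.
  (* This reads psi(c1 y) psi(c2) = psi(c y1) psi(S(y2)); left invariance of psi o S collapses the
     right side. *)
  have := congr1 psi (strong_invariance hH hC c y ipsi).
  rewrite (contr_comp _ _ lpsi') (contr_comp _ _ lpsi').
  have -> : contr (W := k^o) (fun u v => psi (psi (u * y) *: v)) (Delta c) = psi (D c * y).
    rewrite /D /slice (contr_comp _ _ ly); apply: (eq_contr (W := k^o)) => u v.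
    by rewrite (linZ ly) (linZ lpsi') [LHS]mulrC.
  move=> ->; have [_ hS] := right_invariant_antipode ipsi.
  transitivity (psi (c * (psi (S y) *: 1))).
    rewrite -hS (contr_comp _ _ ly'); apply: (eq_contr (W := k^o)) => u v.
    by rewrite (linZ ly') (linZ lpsi') [LHS]mulrC.
  by rewrite (linZ ly') mulr1 [LHS]mulrC.
(* Normalised so that psi(c0) = 1, which makes [d] the common factor. *)
pose c0 := (psi c1)^-1 *: c1; pose d := D c0.
have psic0 : psi c0 = 1 by rewrite /c0 (linZ lpsi') [LHS]mulVf.
have Dd c : D c = psi c *: d.
  apply/eqP; rewrite -subr_eq0; apply/eqP; apply: right_invariant_faithful ipsi _ _.
    by exists c1.
  move=> y; rewrite mulrBl -scalerAl -scaleN1r addrC lpsi (linZ lpsi') !DE psic0.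
  by rewrite mul1r mulN1r addNr.
have Deltad : Delta d = tens T2 d d by apply: (coact_slice hH hC) => // c; apply: Dd.
have epsd : eps d = 1.
  have leps : linear (eps : H -> k^o) by [].
  rewrite /d /D /slice (contr_comp _ _ leps) -psic0.
  rewrite -[RHS](contr_counitl hH (W := k^o) (g := psi)) //.
  by apply: (eq_contr (W := k^o)) => u v; rewrite (linZ leps) [LHS]mulrC.
exists d, (S d); split=> //.
  by have := contr_antipoder hH d; rewrite Deltad contr_tens ?epsd ?scale1r; last by lin.
by have := contr_antipodel hH d; rewrite Deltad contr_tens ?epsd ?scale1r; last by lin.
Qed.

(** Invariance at [d * h] carries an extra [d] on the left, which [d'] cancels. This yields a
    functional whose slices have weight [d']. *)
Lemma left_invariant_translate phi d d' h : left_invariant phi ->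
  d' * d = 1 -> Delta d = tens T2 d d ->
  contr (fun u v => phi (d * v) *: u) (Delta h) = phi (d * h) *: d'.
Proof.
move=> [lphi hphi] dd Dd.
have := congr1 ( *%R d') (hphi (d * h)).
rewrite (contr_coactM hC) ?Dd ?contr_tens; try by lin.
rewrite -scalerAr mulr1 => <-.
rewrite (contr_comp (g := fun t => d' * t)); last by lin.
by apply: eq_contr => u v; rewrite -scalerAr mulrA dd mul1r.
Qed.

End Integrals.

(** * Invertible bimodules over a direct sum of copies of the field *)

Section InvertibleBimodule.
Variables (k : fieldType) (A : lmodType k) (mulA : A -> A -> A) (I : eqType) (p : I -> A).
Variable B : A -> Prop.
Hypotheses (bmulA : bilin mulA) (mulAA : associative mulA).
Hypothesis pp : forall i j, mulA (p i) (p j) = (if i == j then p i else 0).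
Hypothesis p_neq0 : forall i, p i != 0.
Hypothesis Bspan : forall b, B b -> exists (s : seq I) (c : I -> k), b = \sum_(i <- s) c i *: p i.
Local Notation "x ** y" := (mulA x y) (at level 40, left associativity).

Let mZl c x y : (c *: x) ** y = c *: (x ** y). Proof. exact: (linZ (proj1 bmulA y)). Qed.
Let mZr c x y : x ** (c *: y) = c *: (x ** y). Proof. exact: (linZ (proj2 bmulA x)). Qed.
Let m0l y : 0 ** y = 0. Proof. exact: (lin0 (proj1 bmulA y)). Qed.
Let m0r x : x ** 0 = 0. Proof. exact: (lin0 (proj2 bmulA x)). Qed.
Let mSl J (s : seq J) F y : (\sum_(j <- s) F j) ** y = \sum_(j <- s) F j ** y.
Proof. exact: (lin_sum (proj1 bmulA y)). Qed.
Let mSr J (s : seq J) F x : x ** (\sum_(j <- s) F j) = \sum_(j <- s) x ** F j.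
Proof. exact: (lin_sum (proj2 bmulA x)). Qed.
Let pid i : p i ** p i = p i. Proof. by rewrite pp eqxx. Qed.

Lemma coef_mulr b i : B b -> exists c, b ** p i = c *: p i.
Proof.
move=> /Bspan[s [c ->]]; exists (\sum_(j <- s | j == i) c j).
rewrite mSl scaler_suml [RHS]big_mkcond; apply: eq_bigr => j _.
by rewrite mZl pp; case: eqP => [->|]; rewrite ?scaler0.
Qed.

Lemma orthogonal_mul b i j : B b -> i != j -> p i ** b ** p j = 0.
Proof.
by move=> /coef_mulr-/(_ j)[c bc] ij; rewrite -mulAA bc mZr pp (negPf ij) scaler0.
Qed.

Definition generates (X : A -> Prop) := forall a, exists2 s : seq (A * A),
  a = \sum_(q <- s) q.1 ** q.2 & forall q, q \in s -> X q.2.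

Definition stable (X : A -> Prop) := [/\ forall i x, X x -> X (p i ** x),
  forall i x, X x -> X (x ** p i) & forall c x, X x -> X (c *: x)].

(** The local form of invertibility of the bimodule [X], with inverse [Y]. *)
Definition linked (X Y : A -> Prop) i j u v :=
  [/\ X u /\ Y v, p i ** u = u /\ u ** p j = u, p j ** v = v /\ v ** p i = v & u ** v = p i].

Section LocalUnit.
Variables X Y : A -> Prop.
Hypotheses (genX : generates X) (genY : generates Y).
Hypothesis XY : forall x y, X x -> Y y -> B (x ** y).

(** A finite sum of the [p j] replaces a unit: A = AY = (AX)Y and XY in [B] make [a] a sum of
    products x b with b in [B], and each b has finite support. *)
Lemma local_unit a : exists s : seq I, a = \sum_(j <- s) a ** p j.
Proof.
(* Asking this of all larger supports lets two supports be concatenated, so [P] is closed under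
   sums. *)
pose P a := exists s : seq I, forall s', uniq s' -> {subset s <= s'} ->
  \sum_(j <- s') a ** p j = a.
suff [s sP] : P a.
  by exists (undup s); rewrite sP ?undup_uniq // => j; rewrite mem_undup.
have P0 : P 0 by exists [::] => s' _ _; rewrite big1 // => j _; rewrite m0l.
have PD x y : P x -> P y -> P (x + y).
  move=> [s sP] [t tP]; exists (s ++ t) => s' us' sub.
  under eq_bigr => j _ do rewrite (linD (proj1 bmulA _)).
  rewrite big_split /= sP ?tP // => j hj; apply: sub; rewrite mem_cat hj ?orbT //.
have PS J (s : seq J) F : (forall j, P (F j)) -> P (\sum_(j <- s) F j).
  by move=> PF; elim/big_ind: _.
have PM x y : P y -> P (x ** y).
  move=> [s sP]; exists s => s' us' sub.
  by under eq_bigr => j _ do rewrite -mulAA; rewrite -mSr sP.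
have Pp c i : P (c *: p i).
  exists [:: i] => s' us' /(_ i); rewrite inE eqxx => /(_ isT) is'.
  rewrite (bigD1_seq i) //= mZl pid big1 ?addr0 // => j ji.
  by rewrite mZl pp eq_sym (negPf ji) scaler0.
have PB b : B b -> P b by move=> /Bspan[s [c ->]]; apply: PS.
have [s -> sY] := genY a; rewrite big_seq; elim/big_ind: _ => // q /sY Yq.
have [t -> tX] := genX q.1; rewrite mSl big_seq; elim/big_ind: _ => // r /tX Xr.
by rewrite -mulAA; apply: PM; apply/PB/XY.
Qed.

End LocalUnit.

Section Invertible.
Variables X Y : A -> Prop.
Hypotheses (genX : generates X) (genY : generates Y) (stX : stable X) (stY : stable Y).
Hypothesis XY : forall x y, X x -> Y y -> B (x ** y).
Hypothesis YX : forall x y, X x -> Y y -> B (y ** x).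

(** If X Y p_i were 0, then A = (AX)Y would give p_i = p_i p_i = 0. So u v p_i is nonzero for some
    u, v; a local unit for u inserts some p_j, and u p_j v in [B] makes u p_j v p_i a nonzero
    multiple of p_i, which is scaled to p_i. *)
Lemma exists_linked i : exists j u v, linked X Y i j u v.
Proof.
have [[u [v [Xu Yv uv]]]|no] := pselect (exists u v, [/\ X u, Y v & u ** v ** p i <> 0]);
  last first.
  have /eqP[] := p_neq0 i; rewrite -pid.
  have [s {1}-> sY] := genY (p i); rewrite mSl big_seq big1 // => q /sY Yq.
  have [t -> tX] := genX q.1; rewrite !mSl big_seq big1 // => r /tX Xr.
  rewrite -!mulAA mulAA -mulAA; case: (pselect (r.2 ** q.2 ** p i = 0)) => [|n0].
    by rewrite -mulAA => ->; rewrite m0r.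
  by case: no; exists r.2, q.2.
have [s us] := local_unit genX genY XY u.
have [[j uj]|no] := pselect (exists j, u ** p j ** v ** p i <> 0); last first.
  by case: uv; rewrite us !mSl big1 // => j _; apply: contrapT => n; case: no; exists j.
have [X1 X2 X3] := stX; have [Y1 Y2 Y3] := stY.
have [c cE] := coef_mulr i (XY (X2 j _ Xu) Yv).
have c0 : c != 0 by apply/eqP => c0; apply: uj; rewrite cE c0 scale0r.
exists j, (c^-1 *: (p i ** u ** p j)), (p j ** v ** p i); split.
- by split; [apply/X3/X2/X1|apply/Y2/Y1].
- by rewrite mZr mZl !mulAA pid -!mulAA pid.
- by rewrite !mulAA pid -!mulAA pid.
have e : p i ** u ** p j ** (p j ** v ** p i) = p i ** (u ** p j ** v ** p i).
  by rewrite !mulAA -(mulAA _ (p j) (p j)) pid.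
by rewrite mZl e cE mZr pid scalerA mulVf ?scale1r.
Qed.

Lemma linked_neq0 i j u v : linked X Y i j u v -> u <> 0 /\ v <> 0.
Proof.
by move=> [_ _ _ uv]; split=> e; have /eqP[] := p_neq0 i; rewrite -uv e ?m0l ?m0r.
Qed.

(** Write x = p_i x = u (v x p_l). Since v x is in [B] and v = p_j v, the bracket is a multiple of
    p_j if l = j and 0 otherwise. *)
Lemma linked_unique i j l u v x : linked X Y i j u v -> X x ->
  p i ** x = x -> x ** p l = x -> x <> 0 -> l = j /\ exists c, x = c *: u.
Proof.
move=> [[Xu Yv] [pu up] [pv vp] uv] Xx px xp x0.
have xE : x = u ** (v ** x ** p l) by rewrite -!mulAA xp mulAA uv.
have [c cE] := coef_mulr l (YX Xx Yv).
have [e|/eqP jl] := pselect (j = l).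
  by split=> //; exists c; rewrite xE cE mZr -e up.
case: x0; rewrite xE -[v]pv -(mulAA (p j)) orthogonal_mul ?m0r //.
exact: YX.
Qed.

End Invertible.

(** Links for [X] define [mu], links for [Y] its inverse: the [v] of a link for [X] from i to j is a
    nonzero element of p_j Y p_i, so uniqueness for [Y] leads from j back to i, and
    symmetrically. *)
Lemma invertible_bijection X Y : generates X -> generates Y -> stable X -> stable Y ->
  (forall x y, X x -> Y y -> B (x ** y)) -> (forall x y, X x -> Y y -> B (y ** x)) ->
  exists (mu : I -> I) (u : I -> A), bijective mu /\
    forall i, [/\ X (u i), p i ** u i = u i & u i ** p (mu i) = u i] /\
      forall l x, X x -> p i ** x = x -> x ** p l = x -> x <> 0 ->
        l = mu i /\ exists c, x = c *: u i.
Proof.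
move=> genX genY stX stY XY YX.
have YX' y x : Y y -> X x -> B (y ** x) by move=> *; apply: YX.
have XY' y x : Y y -> X x -> B (x ** y) by move=> *; apply: XY.
have eX i : exists t : I * A * A, linked X Y i t.1.1 t.1.2 t.2.
  by have [j [u [v h]]] := exists_linked genX genY stX stY XY i; exists (j, u, v).
have eY i : exists t : I * A * A, linked Y X i t.1.1 t.1.2 t.2.
  by have [j [u [v h]]] := exists_linked genY genX stY stX YX' i; exists (j, u, v).
have [f fP] := choice eX; have [g gP] := choice eY.
exists (fun i => (f i).1.1), (fun i => (f i).1.2); split.
  exists (fun i => (g i).1.1) => i.
    have [_ v0] := linked_neq0 (fP i).
    have [[_ Yv] _ [pv vp] _] := fP i.
    by have [e _] := linked_unique XY' (gP _) Yv pv vp v0; rewrite /= -e.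
  have [_ v0] := linked_neq0 (gP i).
  have [[_ Yv] _ [pv vp] _] := gP i.
  by have [e _] := linked_unique YX (fP _) Yv pv vp v0; rewrite /= -e.
move=> i; have [[Xu _] [pu up] _ _] := fP i; split=> // l x.
exact: (linked_unique YX (fP i)).
Qed.

End InvertibleBimodule.

(** * Consequences of the Galois condition *)

Section Galois.
Variables (k : fieldType) (H : algType k) (T2 : tensor H H) (T3 : tensor T2 H).
Variables (Delta : H -> T2) (eps : H -> k) (S : H -> H).
Variables (A : lmodType k) (mulA : A -> A -> A) (TAH : tensor A H) (T3A : tensor TAH H).
Variables (alpha : A -> TAH) (TB : btensor mulA (coinv alpha)).
Hypothesis hH : hopf T3 Delta eps S.
Hypothesis hA : comod_alg Delta eps mulA T3A alpha.
Hypothesis hG : galois_map_bij TB.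
Let bmulA : bilin mulA. Proof. by case: hA => -[]. Qed.
Let mulAA : associative mulA. Proof. by case: hA => -[]. Qed.
Let lalpha : linear alpha. Proof. by case: hA. Qed.
Let bmulH := bilin_alg_mul H.

(** Take a preimage under the Galois map of w(h)^-1 a (x) h with w(h) nonzero, and apply id (x) w to
    its image. *)
Lemma slice_generates (w : H -> k) : scalar w -> (exists h, w h != 0) ->
  forall a, exists s : seq (A * A), a = \sum_(q <- s) mulA q.1 (slice alpha w q.2).
Proof.
move=> lw [h wh] a; pose m := tensor_mul (T := TAH) mulA *%R.
have bm : bilin m by apply: bilin_tensor_mul.
have bT := tens_bilin TAH.
have bf : bilin (fun a b => m (tens TAH a 1) (alpha b)) by lin.
have mE x t : m (tens TAH x 1) t = contr (fun c d => tens TAH (mulA x c) d) t.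
  rewrite /m /tensor_mul contr_tens; last by lin.
  by apply: eq_contr => c d; rewrite mul1r.
(* [galois_map_bij] concerns a given induced map, so the Galois map has to be constructed; this is
   its balancedness. *)
have bal x b y : coinv alpha b ->
    m (tens TAH (mulA x b) 1) (alpha y) = m (tens TAH x 1) (alpha (mulA b y)).
  have bx : bilin (fun c d => tens TAH (mulA x c) d) by lin.
  move=> cb; rewrite (coactM hA) cb -/m !mE (contr_comp _ _ (lin_contr bx)).
  by apply: eq_contr => c d; rewrite contr_tens ?mulAA //; lin.
have [G [lG GE _]] := @btens_univ _ _ _ _ TB _ _ bf bal.
have [G' _ GK] := hG (tensor_mulP TAH bmulA bmulH) (conj lG GE).
have [s sE] := btens_span (G' (tens TAH ((w h)^-1 *: a) h)).
exists s.
have bw : bilin (fun (x : A) l => w l *: x) by lin.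
have := congr1 (contr (T := TAH) (fun x l => w l *: x)) (GK (tens TAH ((w h)^-1 *: a) h)).
rewrite contr_tens // scalerA mulfV // scale1r => <-.
rewrite sE (lin_sum lG) (lin_sum (lin_contr bw)); apply: eq_bigr => q _.
rewrite GE /m contr_tensor_mul // contr_tens; last by lin.
rewrite /slice contr_comp; last by lin.
by apply: eq_contr => x l; rewrite mul1r (linZ (proj2 bmulA _)).
Qed.

(** For [g = 1] this unfolds to [coinv alpha], so multiplying by [p i] is a case of
    [semi_invariantM]. *)
Definition semi_invariant g (x : A) : Prop := alpha x = tens TAH x g.

Lemma semi_invariantM g h x y : semi_invariant g x -> semi_invariant h y ->
  semi_invariant (g * h) (mulA x y).
Proof.
move=> xg yh; have bT := tens_bilin TAH.
by rewrite /semi_invariant (coactM hA) xg yh /tensor_mul !contr_tens //; lin.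
Qed.

Lemma semi_invariant_stable g (I : eqType) (p : I -> A) :
  (forall i, coinv alpha (p i)) -> stable mulA p (semi_invariant g).
Proof.
move=> cp; split=> [i x xg|i x xg|c x xg].
- by rewrite -[g]mul1r; exact: (semi_invariantM (cp i) xg).
- by rewrite -[g]mulr1; exact: (semi_invariantM xg (cp i)).
- by rewrite /semi_invariant (linZ lalpha) xg (linZ (proj1 (tens_bilin TAH) g)).
Qed.

Lemma semi_invariant_generates (w : H -> k) g : scalar w -> (exists h, w h != 0) ->
  (forall h, contr (fun u v => w v *: u) (Delta h) = w h *: g) ->
  generates mulA (semi_invariant g).
Proof.
move=> lw w0 wg a; have [s ->] := slice_generates lw w0 a.
exists [seq (q.1, slice alpha w q.2) | q <- s]; first by rewrite big_map.
by move=> q /mapP[r _ ->]; apply: (coact_slice hH hA).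
Qed.

End Galois.

(** * The bijection [mu] and the comparison of invariant functionals *)

Theorem mainTheorem18 (k : fieldType) (H : algType k)
  (T2 : tensor H H) (T3 : tensor T2 H)
  (Delta : H -> T2) (eps : H -> k) (S : H -> H) (phi psi : H -> k)
  (A : lmodType k) (mulA : A -> A -> A) (TAH : tensor A H) (T3A : tensor TAH H)
  (alpha : A -> TAH) (TB : btensor mulA (coinv alpha))
  (I : eqType) (p : I -> A) (psiA : A -> k) :
  hopf T3 Delta eps S ->
  left_inv_fun Delta phi -> right_inv_fun Delta psi ->
  comod_alg Delta eps mulA T3A alpha ->
  galois_map_bij TB ->
  coinv_kI mulA alpha p ->
  inv_fun alpha psiA -> left_complete mulA p psiA ->
  exists mu : I -> I,
    [/\ bijective mu,
        (forall i j, (exists a, fij mulA p psiA i j a != 0) <-> j = mu i) &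
        forall psi' : A -> k, inv_fun alpha psi' ->
          exists c : I -> k, forall i j a,
            fij mulA p psi' i j a =
              (if j == mu i then c i else 0) * fij mulA p psiA i j a].
Proof.
move=> hH hphi _ hA hG [cp pp pn0 pspan] ipsi lcomp.
(* An index is needed below to see that [w] is nonzero, so empty [I] is treated apart. *)
have [[i0 _]|noI] := pselect (exists i : I, True); last first.
  have noI' (i : I) : False by apply: noI; exists i.
  exists id; split=> [|i|psi' _]; [by exists id| by case: (noI' i)|].
  by exists (fun=> 0) => i; case: (noI' i).
have [[bmulA mulAA] _ _ _ _] := hA.
have [lphi phi0 _] := hphi; have linvphi := left_inv_fun_invariant hphi.
have lS := linear_antipode hH.
pose w h := phi (S h).
have lw : scalar w by apply: scalar_comp.
have iw : inv_fun Delta w by apply: (left_invariant_antipode hH).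
(* If E(y) p_i were 0 for all y, then A = A E(A) would give p_i = p_i p_i = 0. Otherwise E(y) is
   coinvariant and E(y) p_i = c p_i with c nonzero, so y p_i can be rescaled. *)
have E_proj i : exists a, slice alpha phi a = p i.
  have gE := slice_generates hA hG lphi phi0.
  have [y yi] : exists y, mulA (slice alpha phi y) (p i) <> 0.
    apply: contrapT => no; have /eqP[] := pn0 i.
    have [s sE] := gE (p i); have := pp i i; rewrite eqxx => <-.
    rewrite {1}sE (lin_sum (proj1 bmulA _)) big1 // => q _.
    rewrite -mulAA; case: (pselect (mulA (slice alpha phi q.2) (p i) = 0)) => [->|n0].
      exact: lin0 (proj2 bmulA _).
    by case: no; exists q.2.
  have cE : coinv alpha (slice alpha phi y).
    by apply: (coact_slice hH hA) => //; case: linvphi.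
  have [c cE'] := coef_mulr bmulA pp pspan i cE.
  have c0 : c != 0 by apply/eqP => c0; apply: yi; rewrite cE' c0 scale0r.
  exists (mulA (c^-1 *: y) (p i)).
  rewrite (slice_mulr hA) // (linZ (linear_slice hA lphi)) (linZ (proj1 bmulA _)) cE'.
  by rewrite scalerA mulVf ?scale1r.
have [e eE] := choice E_proj.
have chiE chi i b : inv_fun alpha chi -> chi (mulA (p i) b) = chi (mulA (e i) (slice alpha w b)).
  by move=> ichi; rewrite -eE; apply: (inv_fun_slice hH hA).
have lchi0 chi : inv_fun alpha chi -> chi 0 = 0.
  by move=> [lchi _]; exact: (lin0 (V := k^o) lchi).
(* With w = 0, [chiE] would give psiA(p_i0 a) = 0 for all a, against left completeness. *)
have w0 : exists h, w h != 0.
  apply: contrapT => no; have [a /eqP[]] := lcomp i0.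
  rewrite chiE // /slice /contr big1 => [|q _].
    by rewrite (lin0 (proj2 bmulA _)) lchi0.
  have -> : w q.2 = 0 by apply: contrapT => /eqP n0; apply: no; exists q.2.
  exact: scale0r.
have [d [d' [dd' d'd Dd wd]]] := modular_element hH iw w0.
have genX : generates mulA (semi_invariant alpha d).
  exact: (semi_invariant_generates hH hA hG lw w0 wd).
have genY : generates mulA (semi_invariant alpha d').
  apply: (semi_invariant_generates hH hA hG (w := fun h => phi (d * h))).
  - apply: (scalar_comp (g := phi) (f := fun h => d * h)) => //; lin.
  - by have [h h0] := phi0; exists (d' * h); rewrite mulrA dd' mul1r.
  - by move=> h; apply: (left_invariant_translate hH).
have stX := semi_invariant_stable hA d cp.
have stY := semi_invariant_stable hA d' cp.
have [||mu [u [bmu uP]]] := invertible_bijection bmulA mulAA pp pn0 pspan genX genY stX stY.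
- by move=> x y Xx Yy; have := semi_invariantM hA Xx Yy; rewrite dd'.
- by move=> x y Xx Yy; have := semi_invariantM hA Yy Xx; rewrite d'd.
have XY x y : semi_invariant alpha d x -> semi_invariant alpha d' y -> coinv alpha (mulA x y).
  by move=> Xx Yy; have := semi_invariantM hA Xx Yy; rewrite dd'.
(* The factor [f] is fixed before [chi]; this uniformity makes all invariant functionals
   proportional on each corner. *)
have fijE i j b : exists f : k, forall chi, inv_fun alpha chi ->
    fij mulA p chi i j b = (if j == mu i then chi (mulA (e i) (u i)) else 0) * f.
  pose x := mulA (mulA (p i) (slice alpha w b)) (p j).
  have xE chi : inv_fun alpha chi -> fij mulA p chi i j b = chi (mulA (e i) x).
    move=> ichi; rewrite /fij -mulAA.
    (* Doubling [p i] lets [chiE] trade one copy for [e i] while the other stays with the slice. *)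
    have := pp i i; rewrite eqxx => {1}<-.
    by rewrite -!mulAA chiE // (slice_mull hA) // (slice_mulr hA) // /x !mulAA.
  have Xx : semi_invariant alpha d x.
    case: stX => X1 X2 _; apply/X2/X1.
    exact: (coact_slice hH hA).
  have pid l : mulA (p l) (p l) = p l by rewrite pp eqxx.
  have [x0|x0] := pselect (x = 0).
    exists 0 => chi ichi.
    by rewrite xE // x0 (lin0 (proj2 bmulA _)) lchi0 // mulr0.
  have px : mulA (p i) x = x by rewrite /x !mulAA pid.
  have xp : mulA x (p j) = x by rewrite /x -!mulAA pid.
  have [_ /(_ j x Xx px xp x0)[jm [c xc]]] := uP i; exists c => chi ichi; rewrite xE // xc jm eqxx.
  rewrite (linZ (proj2 bmulA _)); case: ichi => lchi _.
  by rewrite (linZ (V := k^o) lchi) [LHS]mulrC.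
(* Otherwise every psi_ij vanishes, and expanding p_i a by a local unit contradicts left
   completeness. *)
have psiN0 i : psiA (mulA (e i) (u i)) != 0.
  have [a ha] := lcomp i; apply/eqP => psi0; case/eqP: ha.
  have [s ->] := local_unit bmulA mulAA pp pspan genX genY XY (mulA (p i) a).
  case: (ipsi) => lpsi _; rewrite (lin_sum (V := k^o) lpsi) big1 // => j _.
  have [f fE] := fijE i j a; have := fE _ ipsi; rewrite /fij => ->.
  by rewrite psi0 if_same mul0r.
exists mu; split=> // [i j|psi' ipsi'].
  split=> [[a]|->].
    by have [f ->//] := fijE i j a; case: (j =P mu i) => //; rewrite mul0r eqxx.
  (* In the expansion of psiA(p_i a) by a local unit only terms with index mu(i) can survive. *)
  have [a ha] := lcomp i; exists a; apply: contraNneq ha => a0.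
  have [s ->] := local_unit bmulA mulAA pp pspan genX genY XY (mulA (p i) a).
  case: (ipsi) => lpsi _; rewrite (lin_sum (V := k^o) lpsi) big1 // => l _.
  have [->|/eqP lm] := pselect (l = mu i); first exact: a0.
  have [f fE] := fijE i l a; have := fE _ ipsi; rewrite /fij => ->.
  by rewrite (negPf lm) mul0r.
exists (fun i => psi' (mulA (e i) (u i)) / psiA (mulA (e i) (u i))) => i j a.
have [f fE] := fijE i j a; rewrite !fE //; case: eqP => _; last by rewrite !mul0r.
by rewrite mulrA divfK.
Qed.
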